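(* Let $G$ be a $d$-degenerate graph on $n$ vertices. Then the algorithm Fast-OCT-Embed, i.e. its step of decomposing the vertex set of its input graph by running GreedyBipartite, is a $\min(d, n-d)$-approximation for MaxBipartite on $G$. That is, for every run of the algorithm (every choice among minimum-degree vertices), the vertex set $L \cup R$ of the bipartite induced subgraph it computes satisfies $\min(d,n-d)\cdot |L \cup R| \ge \mathrm{OPT}(G)$, where $\mathrm{OPT}(G)$ is the maximum number of vertices of a bipartite induced subgraph of $G$.
   Context: Graphs are finite, simple and undirected. The degeneracy of a graph $G$ is the smallest $k$ such that every subgraph of $G$ has a vertex of degree at most $k$; $G$ is $d$-degenerate if its degeneracy is $d$. An odd cycle transversal (OCT set) of $G$ is a set $S \subseteq V(G)$ such that $G \setminus S = G[V(G)-S]$ is bipartite. MaxBipartite is the problem of finding a bipartite induced subgraph of $G$ with the maximum number of vertices. GreedyIndSet$(G)$: start with $S=\emptyset$; while $G$ is not empty, pick any vertex $v$ of minimum degree in the current graph $G$, add $v$ to $S$, and delete $v$ and all its neighbors from $G$; return $S$. GreedyBipartite$(G)$: let $L = $ GreedyIndSet$(G)$, let $R = $ GreedyIndSet$(G\setminus L)$, and return $L\cup R$. Fast-OCT-Embed: on a problem graph $G$, computes a decomposition $V(G) = S\cup L\cup R$ with $L \cup R$ returned by GreedyBipartite$(G)$ and $S = V(G)\setminus (L\cup R)$ an OCT set, and then maps these sets into a complete bipartite host graph (if it is large enough). Its approximation factor refers to the size of the bipartite induced subgraph $G[L\cup R]$ it computes. An $\alpha$-approximation for a maximization problem is an algorithm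 always returning a feasible solution of size at least $1/\alpha$ times the optimum.
   Formalization: The formal theorem assumes d ≥ 2: for d = 0 the factor min(d, n-d) is 0 while OPT(G) = n, and for d = 1 the claim fails on the path a-b-c-d, where choosing a and then d gives L = {a, d}, |R| = 1, so |L ∪ R| = 3 < 4 = OPT(G). *)

(* Defs.v *)
(* A finite simple graph is a symmetric irreflexive relation
   [e] on a finType [T]; induced subgraphs are given by vertex sets. *)
From mathcomp Require Import all_boot.

Set Implicit Arguments.
Unset Strict Implicit.
Unset Printing Implicit Defensive.

Section Graphs.
Variables (T : finType) (e : rel T).
Implicit Types (B S L R I : {set T}) (v : T).

Definition nbhd v : {set T} := [set u | e v u].

Definition degree_in B v : nat := #|nbhd v :&: B|.

(* Arbitrary, not necessarily induced, subgraphs (B, f). *)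
Definition subgraph B (f : rel T) : Prop :=
  symmetric f /\ (forall x y, f x y -> [/\ x \in B, y \in B & e x y]).

Definition low_degree_vertices (k : nat) : Prop :=
  forall B (f : rel T), subgraph B f -> B != set0 ->
    exists2 v, v \in B & #|[set u | f v u]| <= k.

(* The degeneracy is exactly [d], not merely at most [d]. *)
Definition degenerate (d : nat) : Prop :=
  low_degree_vertices d /\ (forall k, low_degree_vertices k -> d <= k).

Definition bipartite_in B : bool :=
  [exists c : {ffun T -> bool},
    [forall x in B, forall y in B, e x y ==> (c x != c y)]].

Definition max_bipartite : nat := \max_(B : {set T} | bipartite_in B) #|B|.

(* [greedy_loop B S I]: from current graph B and partial output S, some
   sequence of choices of minimum-degree vertices makes the loop return I. *)
Inductive greedy_loop : {set T} -> {set T} -> {set T} -> Prop :=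
| GreedyStop S : greedy_loop set0 S S
| GreedyStep B S I v :
    v \in B ->
    (forall u, u \in B -> degree_in B v <= degree_in B u) ->
    greedy_loop (B :\: (v |: nbhd v)) (v |: S) I ->
    greedy_loop B S I.

Definition greedy_ind_set B I : Prop := greedy_loop B set0 I.

Definition greedy_bipartite L R : Prop :=
  greedy_ind_set setT L /\ greedy_ind_set (~: L) R.

(* Only the decomposition step: the embedding into the host graph does not
   affect the set L :|: R to which the approximation factor refers.
   The factor minn d (n - d) fails for d <= 1. If d = 0 it is 0. If d = 1, on
   the path a-b-c-d the run choosing a and then d returns L = {a, d}, after
   which R is one of {b}, {c}: 3 vertices, while the whole path is bipartite. *)
Definition fast_oct_decomposition S L R : Prop :=
  greedy_bipartite L R /\ S = ~: (L :|: R).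

End Graphs.

(* Main.v *)
(* Each greedy step deletes at most d + 1 vertices, so |L| >= n / (d + 1) and
   |R| >= (n - |L|) / (d + 1); together these give d |L u R| >= n as soon as
   d (2 d + 1) >= (d + 1)^2, that is, d >= 2.
   For the other bound, an independent set I forces degeneracy at most n - |I|:
   in a subgraph, either some vertex lies in I and has all its neighbours
   outside I, or the whole subgraph lies outside I. Hence every independent set
   has at most n - d vertices and every bipartite induced subgraph at most
   2 (n - d), while L and R are both nonempty. *)
Require Import Defs.
From mathcomp Require Import all_boot.
From mathcomp Require Import zify.

Definition independent {T : finType} (e : rel T) (I : {set T}) : Prop :=
  {in I &, forall x y, ~~ e x y}.

Lemma independent_low_degree {T : finType} {e : rel T} {I : {set T}} :
  independent e I -> low_degree_vertices e (#|T| - #|I|).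
Proof.
move=> indI B f [_ f_sub] /set0Pn[w wB].
rewrite -(setCK I) -cardsCs.
have [disjBI | ] := boolP [disjoint B & I].
  exists w => //; apply/subset_leq_card/subsetP => u.
  rewrite inE => /f_sub[_ uB _]; rewrite inE.
  by rewrite (disjointFr disjBI uB).
rewrite -setI_eq0 => /set0Pn[v /setIP[vB vI]].
exists v => //; apply/subset_leq_card/subsetP => u.
rewrite inE => /f_sub[_ _ evu]; rewrite inE.
by apply: contraL evu => uI; apply: indI.
Qed.

Lemma independent_degenerate {T : finType} {e : rel T} {d : nat} {I : {set T}} :
  degenerate e d -> independent e I -> d <= #|T| - #|I|.
Proof. by move=> [_ d_min] /independent_low_degree/d_min. Qed.

Lemma bipartite_card {T : finType} {e : rel T} {d : nat} {B : {set T}} :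
  degenerate e d -> bipartite_in e B -> #|B| <= (#|T| - d).*2.
Proof.
move=> e_degen /existsP[c /forall_inP c_proper].
pose side b := B :&: [set x | c x == b].
have side_card b : #|side b| <= #|T| - d.
  have indep_b : independent e (side b).
    move=> x y /setIP[xB]; rewrite inE => /eqP cx /setIP[yB].
    rewrite inE => /eqP cy; apply/negP => exy.
    by have /forall_inP/(_ y yB) := c_proper x xB; rewrite exy cx cy eqxx.
  have := independent_degenerate e_degen indep_b.
  (* Truncated subtraction: [d <= #|T| - #|side b|] can be turned around only once
     [#|side b| <= #|T|] is known. *)
  have : #|side b| <= #|T| := max_card _.
  by lia.
have -> : B = side true :|: side false.
  by apply/setP => x; rewrite !inE -andb_orr; case: (c x); rewrite andbT.
by rewrite cardsU; have := side_card true; have := side_card false; lia.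
Qed.

(** Apply the degeneracy bound to the subgraph induced on [B], where the degree of [u] is
    [degree_in e B u]. *)
Lemma exists_degree_in_le {T : finType} {e : rel T} {d : nat} {B : {set T}} :
  symmetric e -> low_degree_vertices e d -> B != set0 ->
  exists2 u, u \in B & degree_in e B u <= d.
Proof.
move=> e_sym e_low B_neq0.
have sub_B : subgraph e B [rel x y | [&& x \in B, y \in B & e x y]].
  split=> [x y /= | x y /and3P[]//].
  by rewrite e_sym andbCA.
have [u uB deg_u] := e_low _ _ sub_B B_neq0.
exists u => //; apply: leq_trans deg_u; apply/subset_leq_card/subsetP => x.
by rewrite !inE /= uB => /andP[-> ->].
Qed.

Lemma greedy_loop_sub {T : finType} {e : rel T} {B S I : {set T}} :
  greedy_loop e B S I -> S \subset I /\ I \subset S :|: B.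
Proof.
elim=> {B S I} [S | B S I v vB _ _ [sub_vSI sub_I]].
  by rewrite setU0 subxx.
split; first by apply: subset_trans sub_vSI; apply: subsetUr.
apply: subset_trans sub_I _; apply/subsetP => x; rewrite !inE.
by case/orP=> [/orP[/eqP-> | ->] | /andP[_ ->]]; rewrite ?vB ?orbT.
Qed.

(** Loop invariant: no edge inside [S] and none between [S] and [B]. Deleting all neighbours of [v]
    preserves the second half. *)
Lemma greedy_loop_independent {T : finType} {e : rel T} {B S I : {set T}} :
  symmetric e -> irreflexive e -> greedy_loop e B S I ->
  independent e S -> {in S & B, forall x y, ~~ e x y} -> independent e I.
Proof.
move=> e_sym e_irr; elim=> {B S I} // B S I v vB _ _ IH indS indSB.
apply: IH => [x y | x y].
  move=> /setU1P[-> | xS] /setU1P[-> | yS].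
  - by rewrite e_irr.
  - by rewrite e_sym indSB.
  - exact: indSB.
  - exact: indS.
move=> /setU1P[-> | xS]; rewrite !inE negb_or => /andP[/andP[_ Nevy] yB] //.
exact: indSB.
Qed.

(** The potential [#|B| + d.+1 * #|S|] never decreases: a step removes at most [d.+1] vertices from
    [B] and, by disjointness, adds a new one to [S]. At the end [B] is empty. *)
Lemma greedy_loop_card {T : finType} {e : rel T} {d : nat} {B S I : {set T}} :
  symmetric e -> low_degree_vertices e d -> greedy_loop e B S I ->
  [disjoint S & B] -> #|B| + d.+1 * #|S| <= d.+1 * #|I|.
Proof.
move=> e_sym e_low; elim=> {B S I} [S | B S I v vB v_min _ IH disjSB].
  by rewrite cards0.
have vNS : v \notin S by rewrite (disjointFl disjSB vB).
have B_neq0 : B != set0 by apply/set0Pn; exists v.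
have [u uB deg_u] := exists_degree_in_le e_sym e_low B_neq0.
have deg_v : degree_in e B v <= d := leq_trans (v_min u uB) deg_u.
have disj' : [disjoint v |: S & B :\: (v |: nbhd e v)].
  rewrite -setI_eq0; apply/eqP/setP => x; rewrite !inE.
  have [-> | _] := eqVneq x v; first by [].
  by case xS: (x \in S) => //=; rewrite (disjointFr disjSB xS) andbF.
have := IH disj'; rewrite cardsU1 vNS.
have cardB : #|B| <= #|B :\: (v |: nbhd e v)| + d.+1.
  rewrite -(cardsID (v |: nbhd e v) B) addnC leq_add2l setIUr.
  apply: leq_trans (leq_card_setU _ _) _; rewrite -add1n leq_add //.
    by rewrite -(cards1 v) subset_leq_card // subsetIr.
  by rewrite setIC.
by lia.
Qed.

Lemma greedy_ind_set_sub {T : finType} {e : rel T} {B I : {set T}} :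
  greedy_ind_set e B I -> I \subset B.
Proof. by case/greedy_loop_sub; rewrite set0U. Qed.

Lemma greedy_ind_set_independent {T : finType} {e : rel T} {B I : {set T}} :
  symmetric e -> irreflexive e -> greedy_ind_set e B I -> independent e I.
Proof.
move=> e_sym e_irr /(greedy_loop_independent e_sym e_irr).
by apply=> x y; rewrite inE.
Qed.

Lemma greedy_ind_set_card {T : finType} {e : rel T} {d : nat} {B I : {set T}} :
  symmetric e -> low_degree_vertices e d -> greedy_ind_set e B I ->
  #|B| <= d.+1 * #|I|.
Proof.
move=> e_sym e_low /(greedy_loop_card e_sym e_low).
by rewrite cards0 muln0 addn0; apply; rewrite -setI_eq0 set0I.
Qed.

Lemma greedy_bipartiteP {T : finType} {e : rel T} {L R : {set T}} :
  symmetric e -> irreflexive e -> greedy_bipartite e L R ->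
  bipartite_in e (L :|: R).
Proof.
move=> e_sym e_irr [runL runR].
have indL := greedy_ind_set_independent e_sym e_irr runL.
have indR := greedy_ind_set_independent e_sym e_irr runR.
(* Colour by membership in [L]; a vertex of the union outside [L] lies in [R]. *)
apply/existsP; exists [ffun x => x \in L].
apply/forall_inP => x xLR; apply/forall_inP => y yLR; apply/implyP => exy.
move: xLR yLR; rewrite !ffunE !inE.
have [xL | _] := boolP (x \in L); have [yL | _] := boolP (y \in L) => //=.
  by move: (indL x y xL yL); rewrite exy.
by move=> xR yR; move: (indR x y xR yR); rewrite exy.
Qed.

Theorem proposition4 (T : finType) (e : rel T) (n d : nat)
  (e_sym : symmetric e) (e_irr : irreflexive e)
  (card_T : #|T| = n) (e_degen : degenerate e d) (d_gt1 : 1 < d)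
  (S L R : {set T}) (run : fast_oct_decomposition e S L R) :
  bipartite_in e (L :|: R) /\
  max_bipartite e <= minn d (n - d) * #|L :|: R|.
Proof.
case: run => runLR _; split; first exact: greedy_bipartiteP.
case: runLR => runL runR; subst n.
have [e_low _] := e_degen.
have := greedy_ind_set_card e_sym e_low runL; rewrite cardsT => cardL.
have := greedy_ind_set_card e_sym e_low runR; rewrite cardsCs setCK => cardR.
(* Since [0 < d], this leaves vertices outside [L], so neither greedy run starts from an empty graph
   and both outputs are nonempty. *)
have gapL := independent_degenerate e_degen
               (greedy_ind_set_independent e_sym e_irr runL).
have cardLR : #|L :|: R| = #|L| + #|R|.
  rewrite cardsU (_ : L :&: R = set0) ?cards0 ?subn0 //.
  apply/eqP; rewrite setI_eq0 disjoint_sym disjoints_subset.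
  exact: greedy_ind_set_sub runR.
have L_gt0 : 0 < #|L| by nia.
have R_gt0 : 0 < #|R| by nia.
apply/bigmax_leqP => B bipB; rewrite minnMl leq_min cardLR; apply/andP; split.
  (* With l, r the sizes of [L], [R]: if r <= (d - 1) l, then [cardR] gives n <= l + (d + 1) r <= d
     (l + r). Otherwise l <= r because d >= 2, and [cardL] gives n <= (d + 1) l <= d (l + r). *)
  by apply: leq_trans (max_card _) _; nia.
apply: leq_trans (bipartite_card e_degen bipB) _.
by rewrite -muln2 leq_mul2l; lia.
Qed.
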